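(* $\delta(11\text{-}2)=\delta'(11\text{-}2)=1$.
   Context: $[k]=\{1,\dots,k\}$ and $[k]^n$ is the set of words of length $n$ over $[k]$. $\pi=11\text{-}2$ is a generalized pattern of length $m=3$ with $b=2$ blocks: an occurrence of it in a word $\sigma=\sigma_1\cdots\sigma_n$ is a subsequence $\sigma_i\sigma_{i+1}\sigma_j$ with $j>i+1$ and $\sigma_i=\sigma_{i+1}<\sigma_j$ (the first two letters must be adjacent in $\sigma$). $\nu(\pi,\sigma)$ is the number of occurrences of $\pi$ in $\sigma$. For $n\ge m$, $\delta(\pi,k,n)=\max\{\nu(\pi,\sigma):\sigma\in[k]^n\}/\binom{n-m+b}{b}$, which here has denominator $\binom{n-1}{2}$. Then $\delta(\pi)=\lim_{n\to\infty}\lim_{k\to\infty}\delta(\pi,k,n)=\lim_{n\to\infty}\delta(\pi,n,n)$ (for $k\ge n$, $\delta(\pi,k,n)=\delta(\pi,n,n)$) and $\delta'(\pi)=\lim_{k\to\infty}\lim_{n\to\infty}\delta(\pi,k,n)$. *)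

(* Defs.v *)
From HB Require Import structures.
From mathcomp Require Import all_boot all_order all_algebra.
From mathcomp Require Import all_classical all_reals all_analysis.
Set Implicit Arguments.
Unset Strict Implicit.
Unset Printing Implicit Defensive.
Import Order.TTheory GRing.Theory Num.Theory.
Import numFieldNormedType.Exports.
Local Open Scope ring_scope.

(* A generalized pattern is the sequence of its blocks, so that 11-2 is
   [:: [:: 1; 1]; [:: 2]]. *)
Definition gpattern := seq (seq nat).

Definition letters (p : gpattern) : seq nat := flatten p.
Definition plength (p : gpattern) : nat := size (letters p).
Definition nblocks (p : gpattern) : nat := size p.

Definition same_block (p : gpattern) (a b : nat) : bool :=
  reshape_index (shape p) a == reshape_index (shape p) b.

Definition pattern_11_2 : gpattern := [:: [:: 1; 1]; [:: 2]]%N.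

(* Words of [k]^n are n.-tuple 'I_k, i.e. the letters are shifted to
   0, ..., k-1; only their relative order is used.  Positions are 0-based too.
   An occurrence is identified with the positions t 0 < t 1 < ... of its
   letters: two occurrences with the same letters at different positions are
   distinct. *)
Definition occurrence (p : gpattern) (k n : nat) (s : n.-tuple 'I_k)
    (t : {ffun 'I_(plength p) -> 'I_n}) : bool :=
  [&& [forall a : 'I_(plength p), forall b : 'I_(plength p),
         (a < b)%N ==> (t a < t b)%N],
      [forall a : 'I_(plength p), forall b : 'I_(plength p),
         ((b == a.+1 :> nat) && same_block p a b) ==> (t b == (t a).+1 :> nat)]
    & [forall a : 'I_(plength p), forall b : 'I_(plength p),
         (tnth s (t a) < tnth s (t b))%N
           == (nth 0 (letters p) a < nth 0 (letters p) b)%N] ].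

Arguments occurrence p {k n} s t.

Definition nu (p : gpattern) (k n : nat) (s : n.-tuple 'I_k) : nat :=
  #|[set t | occurrence p s t]%SET|.

(* Meaningful only for plength p <= n; for n < plength p the subtraction
   n - plength p is truncated, but limits as n tends to infinity ignore this. *)
Definition density (R : realType) (p : gpattern) (k n : nat) : R :=
  (\max_(s : n.-tuple 'I_k) nu p s)%:R
    / ('C(n - plength p + nblocks p, nblocks p))%:R.

Definition delta (R : realType) (p : gpattern) : R :=
  limn (fun n => limn (fun k => density R p k n)).

Definition delta' (R : realType) (p : gpattern) : R :=
  limn (fun k => limn (fun n => density R p k n)).

(* limn is total, so the existence of the limits has to be expressed apart. *)
Definition delta_exists (R : realType) (p : gpattern) : Prop :=
  (forall n, (plength p <= n)%N -> cvgn (fun k => density R p k n)) /\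
  cvgn (fun n => limn (fun k => density R p k n)).

Definition delta'_exists (R : realType) (p : gpattern) : Prop :=
  (forall k, (0 < k)%N -> cvgn (fun n => density R p k n)) /\
  cvgn (fun k => limn (fun n => density R p k n)).

(* Main.v *)
Require Import Defs.
From mathcomp Require Import all_boot all_order all_algebra.
From mathcomp Require Import all_classical all_reals all_analysis.
From mathcomp Require Import zify ring lra.
Import Order.TTheory GRing.Theory Num.Theory.
Import numFieldNormedType.Exports.
Local Open Scope ring_scope.

(** A word over [k] letters in which every letter occurs about [n / k] times, in
    increasing constant blocks 1...1 2...2 ... k...k, has an occurrence of 11-2
    for every pair of positions in different blocks, but for those whose smaller
    position ends its block. These number about [(1 - 1/k) n^2 / 2], with an
    error linear in [n] for fixed [k] ([nb_occ_pairs_blocks]).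

    Up to this error, no word does better: the first and the last position of
    an occurrence determine it and carry different letters, and by
    Cauchy-Schwarz at least [n^2 / k] ordered pairs of positions carry equal
    letters ([nu_11_2_ub]).

    As ['C(n - 1, 2)] is equivalent to [n^2 / 2], for fixed [k] the density
    tends to [1 - 1/k] as [n] grows ([cvg_density_n]), and this tends to 1
    as [k] grows.

    For the limits in the other order, the density at fixed [n] is nondecreasing
    in [k], because a word over [k] letters is a word over [k + 1] letters, and
    is bounded by [1 + O(1/n)] uniformly in [k]. Hence its limit in [k] exists
    and lies between the density at any fixed [K] and [1 + O(1/n)]; letting [n]
    grow, then [K], squeezes it to 1 ([cvg_lim_density_k]). *)

(** * Occurrences of 11-2 as pairs of positions *)

Definition letter {k n : nat} (s : n.-tuple 'I_k) (i : nat) : nat :=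
  nth 0%N (map val s) i.

(** The first position of an occurrence of 11-2 determines the second, so the
    first and the last position, [i] and [j], are enough to describe it. *)
Definition occ_pair (w : nat -> nat) (i j : nat) : bool :=
  [&& (i.+1 < j)%N, w i == w i.+1 & (w i < w j)%N].

Definition nb_occ_pairs (n : nat) (w : nat -> nat) : nat :=
  (\sum_(i < n) \sum_(j < n) occ_pair w i j)%N.

Lemma letterE (k n : nat) (s : n.-tuple 'I_k) (i : 'I_n) :
  letter s i = tnth s i.
Proof.
have x0 := tnth s i.
by rewrite /letter (nth_map x0) ?size_tuple // (tnth_nth x0).
Qed.

Lemma occurrence_11_2E (k n : nat) (s : n.-tuple 'I_k)
    (t : {ffun 'I_3 -> 'I_n}) :
  occurrence pattern_11_2 s t =
  (t (inord 1) == (t ord0).+1 :> nat)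
    && occ_pair (letter s) (t ord0) (t (inord 2)).
Proof.
pose a0 := @Ordinal 3 0 isT; pose a1 := @Ordinal 3 1 isT.
pose a2 := @Ordinal 3 2 isT.
have -> : inord 1 = a1 by apply: val_inj; rewrite /= inordK.
have -> : inord 2 = a2 by apply: val_inj; rewrite /= inordK.
have -> : ord0 = a0 by apply: val_inj.
rewrite /occ_pair.
have cases (x : 'I_3) : [\/ x = a0, x = a1 | x = a2].
  case: x => -[|[|[|i]]] hx //.
  - by apply: Or31; apply: val_inj.
  - by apply: Or32; apply: val_inj.
  - by apply: Or33; apply: val_inj.
apply/and3P/and4P => [[/forallP h1 /forallP h2 /forallP h3]|[/eqP h1 h2 h3 h4]].
  have /implyP/(_ isT) /eqP e1 := forallP (h2 a0) a1.
  have /implyP/(_ isT) l12 := forallP (h1 a1) a2.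
  have /eqP := forallP (h3 a0) a1; have /eqP := forallP (h3 a1) a0.
  have /eqP := forallP (h3 a0) a2.
  rewrite -e1 !letterE /= => -> c10 c01; split=> //.
  by move: c10 c01; case: ltngtP.
move: h3 h4; rewrite -h1 !letterE => /eqP h3 h4.
have l01 : (t a0 < t a1)%N by rewrite h1.
have l12 : (t a1 < t a2)%N by rewrite h1.
have l02 := ltn_trans l01 l12.
have lts : ((tnth s (t a0) < tnth s (t a1))%N = false) *
    ((tnth s (t a1) < tnth s (t a0))%N = false) *
    ((tnth s (t a0) < tnth s (t a2))%N = true) *
    ((tnth s (t a2) < tnth s (t a0))%N = false) *
    ((tnth s (t a1) < tnth s (t a2))%N = true) *
    ((tnth s (t a2) < tnth s (t a1))%N = false).
  by rewrite -h3 ltnn h4 [(tnth s (t a2) < _)%N]ltnNge ltnW.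
split; apply/forallP=> a; apply/forallP => b.
- by case: (cases a) => ->; case: (cases b) => -> //=.
- case: (cases a) => ->; case: (cases b) => -> //=;
  by rewrite /same_block /= ?h1 ?eqxx.
- by case: (cases a) => ->; case: (cases b) => ->; rewrite ?ltnn ?lts.
Qed.

Lemma nu_11_2E (k n : nat) (s : n.-tuple 'I_k) :
  nu pattern_11_2 s = nb_occ_pairs n (letter s).
Proof.
pose P := [set p : 'I_n * 'I_n | occ_pair (letter s) p.1 p.2]%SET.
(* the default value of nth provides the last position; the one of insubd is
   never reached at an occurrence *)
pose emb (p : 'I_n * 'I_n) : {ffun 'I_3 -> 'I_n} :=
  [ffun a : 'I_3 => nth p.2 [:: p.1; insubd p.1 p.1.+1] a].
have emb0 p : emb p ord0 = p.1 by rewrite ffunE.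
have emb1 p : emb p (inord 1) = insubd p.1 p.1.+1 by rewrite ffunE inordK.
have emb2 p : emb p (inord 2) = p.2 by rewrite ffunE inordK.
have emb_inj : injective emb.
  by move=> p q e; rewrite [p]surjective_pairing [q]surjective_pairing
    -!emb0 -!emb2 e.
have -> : nb_occ_pairs n (letter s) = #|P|.
  rewrite /nb_occ_pairs pair_big /= -sum1dep_card [RHS]big_mkcond /=.
  by apply: eq_bigr => p _; case: occ_pair.
rewrite -(card_imset _ emb_inj) /nu; congr #|pred_of_set _|.
apply/setP => t; rewrite inE occurrence_11_2E; apply/idP/imsetP.
  case/andP=> /eqP t1 occ; exists (t ord0, t (inord 2)); first by rewrite inE.
  apply/ffunP => -[[|[|[|//]]] hx]; rewrite ffunE /=.
  - by congr (t _); apply: val_inj.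
  - apply: val_inj; rewrite val_insubd -t1 ltn_ord.
    by congr (\val (t _)); apply: val_inj; rewrite /= inordK.
  - by congr (t _); apply: val_inj; rewrite /= inordK.
case=> p; rewrite inE => occ ->; rewrite emb0 emb1 emb2 occ andbT val_insubd.
by case/and3P: occ => lt_ij _ _; rewrite (ltn_trans lt_ij).
Qed.

(** * Upper bound on the number of occurrences *)

Lemma sum_nat_const_ord (n m : nat) : (\sum_(i < n) m = n * m)%N.
Proof. by rewrite sum_nat_const card_ord. Qed.

Lemma sqrn_sum1 (n : nat) : (n ^ 2 = \sum_(i < n) \sum_(j < n) 1)%N.
Proof. by rewrite !sum_nat_const_ord muln1 mulnn. Qed.

(** This is Cauchy-Schwarz: if [a c] indices are mapped to [c], the double sum
    is the sum of the [a c ^ 2], while [n] is the sum of the [a c]. *)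
Lemma leq_sqr_card_fibers (k n : nat) (f : 'I_n -> 'I_k) :
  (n ^ 2 <= k * \sum_(i < n) \sum_(j < n) (f i == f j))%N.
Proof.
pose a (c : 'I_k) := (\sum_(i < n) (f i == c))%N.
have sum_a : (\sum_c a c = n)%N.
  rewrite exchange_big /= -[RHS]card_ord -sum1_card; apply: eq_bigr => i _.
  by rewrite (bigD1 (f i)) //= eqxx big1 // => c /negPf; rewrite eq_sym => ->.
have sum_a2 : (\sum_(i < n) \sum_(j < n) (f i == f j) = \sum_c a c ^ 2)%N.
  under [RHS]eq_bigr => c _ do rewrite -mulnn big_distrlr /=.
  rewrite [RHS]exchange_big /=; apply: eq_bigr => i _.
  rewrite [RHS]exchange_big /=; apply: eq_bigr => j _.
  rewrite (bigD1 (f i)) //= eqxx mul1n big1 ?addn0; first by rewrite eq_sym.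
  by move=> c /negPf; rewrite eq_sym => ->.
rewrite sum_a2 -(leq_pmul2l (isT : 0 < 2)%N).
have dbl : (2 * (k * \sum_c a c ^ 2) =
    \sum_(c : 'I_k) \sum_(d : 'I_k) (a c ^ 2 + a d ^ 2))%N.
  under [RHS]eq_bigr => c _ do rewrite big_split /= sum_nat_const_ord.
  by rewrite big_split /= -big_distrr /= sum_nat_const_ord mul2n addnn.
rewrite dbl -{1}sum_a -mulnn big_distrlr /= big_distrr /=.
apply: leq_sum => c _; rewrite big_distrr /=; apply: leq_sum => d _.
exact: (nat_Cauchy (a c) (a d)).1.
Qed.

(** Counting each occurrence at (i, j) and at (j, i) makes it possible to
    compare numbers of occurrences with [n ^ 2] term by term. *)
Lemma nb_occ_pairs_double (n : nat) (w : nat -> nat) :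
  (2 * nb_occ_pairs n w =
    \sum_(i < n) \sum_(j < n) (occ_pair w i j + occ_pair w j i))%N.
Proof.
rewrite mul2n -addnn {2}/nb_occ_pairs exchange_big -big_split /=.
by apply: eq_bigr => i _; rewrite big_split.
Qed.

(** An ordered pair of positions with equal letters contributes nothing to the
    sum in [nb_occ_pairs_double], and any other pair at most 1; at least
    [n ^ 2 / k] of the [n ^ 2] ordered pairs have equal letters. *)
Lemma nu_11_2_ub (k n : nat) (s : n.-tuple 'I_k) :
  (k * (2 * nu pattern_11_2 s) + n ^ 2 <= k * n ^ 2)%N.
Proof.
rewrite nu_11_2E nb_occ_pairs_double.
apply: (leq_trans (leq_add (leqnn _) (leq_sqr_card_fibers k n (tnth s)))).
rewrite -mulnDr leq_mul2l sqrn_sum1 -big_split /=.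
apply/orP; right; apply: leq_sum => i _.
rewrite -big_split /=; apply: leq_sum => j _.
rewrite -val_eqE /= -!letterE /occ_pair; set u := letter s.
by case: (ltngtP (u i) (u j)) => _; rewrite !(andbT, andbF) //; lia.
Qed.

(** * Words made of constant blocks *)

Lemma leq_card_block (n L q : nat) : (0 < L)%N ->
  (\sum_(j < n) ((j %/ L)%N == q) <= L)%N.
Proof.
move=> L0.
have -> : (\sum_(j < n) ((j %/ L)%N == q) =
    #|[set j : 'I_n | (j %/ L)%N == q]%SET|)%N.
  by rewrite -sum1dep_card [RHS]big_mkcond; apply: eq_bigr => j _; case: eqP.
have r_lt (j : 'I_n) : (j %% L < L)%N by rewrite ltn_pmod.
rewrite -{2}(card_ord L) -(@card_in_imset _ _ (fun j => Ordinal (r_lt j))).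
  exact: max_card.
move=> i j; rewrite !inE => /eqP qi /eqP qj [rij]; apply: val_inj.
by rewrite /= (divn_eq i L) (divn_eq j L) qi qj rij.
Qed.

(** In the word whose blocks 0...0, 1...1, 2...2, and so on have length [L], a
    pair of positions in different blocks gives an occurrence unless the smaller
    one is the last of its block. At most [n * L] ordered pairs lie in one
    block, and [n %/ L] positions end a block. *)
Lemma nb_occ_pairs_blocks (n L : nat) : (0 < L)%N ->
  (n ^ 2 <= 2 * nb_occ_pairs n (fun i => i %/ L) + n * L
    + 2 * (n * (n %/ L)))%N.
Proof.
move=> L0; set w := fun i : nat => (i %/ L)%N.
pose last_in (i : nat) : nat := (L %| i.+1)%N.
have sum_last : (\sum_(i < n) last_in i = n %/ L)%N.
  by rewrite divn_count_dvd big_add1 /= big_mkord.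
have same : (\sum_(i < n) \sum_(j < n) (w i == w j) <= n * L)%N.
  rewrite -sum_nat_const_ord; apply: leq_sum => i _.
  by under eq_bigr => j _ do rewrite eq_sym; exact: leq_card_block.
have ends : (\sum_(i < n) \sum_(j < n) (last_in i + last_in j) =
    2 * (n * (n %/ L)))%N.
  under eq_bigr => i _ do rewrite big_split /= sum_nat_const_ord sum_last.
  rewrite big_split /= -big_distrr /= sum_last sum_nat_const_ord.
  by rewrite mul2n addnn.
apply: (leq_trans _ (leq_add (leq_add (leqnn _) same) (leqnn _))).
rewrite -ends nb_occ_pairs_double -!big_split /= sqrn_sum1.
apply: leq_sum => i _; rewrite -!big_split /=; apply: leq_sum => j _.
have key (x y : nat) : (w x < w y)%N -> (0 < occ_pair w x y + last_in x)%N.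
  move=> lt_xy; rewrite /last_in; case: (boolP (L %| x.+1)%N) => [|ndiv].
    by rewrite addn1.
  have exS : w x.+1 = w x by rewrite /w divnS // (negPf ndiv).
  have lt_Sxy : (x.+1 < y)%N.
    rewrite ltnNge; apply/negP => /(leq_div2r L).
    by rewrite -/(w y) -/(w x.+1) exS leqNgt lt_xy.
  by rewrite /occ_pair lt_Sxy exS eqxx lt_xy.
case: (ltngtP (w i) (w j)) => [/key|/key|_]; lia.
Qed.

(** * Bounds on the maximal number of occurrences *)

Lemma max_nu_lb (k n : nat) :
  (k.+1 * n ^ 2 <= k.+1 * (2 * \max_(s : n.-tuple 'I_k.+1) nu pattern_11_2 s)
    + n ^ 2 + (k.+1 + 2 * k.+1 ^ 2) * n)%N.
Proof.
(* about n / k.+1, and large enough for the blocks to number at most k.+1 *)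
pose L := (n %/ k.+1).+1.
pose s : n.-tuple 'I_k.+1 := [tuple inord (i %/ L)%N | i < n].
have nlt : (n < k.+1 * L)%N.
  by rewrite /L mulnC {1}(divn_eq n k.+1) mulSn addnC ltn_add2r ltn_pmod.
have nL : (n %/ L < k.+1)%N by rewrite ltn_divLR.
have lets (i : 'I_n) : letter s i = (i %/ L)%N.
  rewrite letterE tnth_mktuple inordK // (leq_ltn_trans _ nL) //.
  by rewrite leq_div2r // ltnW.
have nus : nu pattern_11_2 s = nb_occ_pairs n (fun i => i %/ L)%N.
  rewrite nu_11_2E; apply: eq_bigr => i _; apply: eq_bigr => j _.
  congr nat_of_bool; rewrite /occ_pair !lets; case: ltnP => //= lt_ij.
  by rewrite -(lets (Ordinal (ltn_trans lt_ij (ltn_ord j)))).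
have leM := leq_bigmax (F := fun s : n.-tuple 'I_k.+1 => nu pattern_11_2 s) s.
have blocks := nb_occ_pairs_blocks n L isT; rewrite -nus in blocks.
have leL : (k.+1 * L <= n + k.+1)%N.
  by rewrite /L mulnS addnC leq_add2r mulnC leq_trunc_div.
have arith (K l q v M : nat) : (n ^ 2 <= 2 * v + n * l + 2 * (n * q))%N ->
    (K * l <= n + K)%N -> (q < K)%N -> (v <= M)%N ->
    (K * n ^ 2 <= K * (2 * M) + n ^ 2 + (K + 2 * K ^ 2) * n)%N.
  move=> hv hl hq hM.
  have h1 := leq_mul (leqnn K) hv.
  have h2 := leq_mul (leqnn n) hl.
  have h3 := leq_mul (leqnn K) hM.
  have h4 := leq_mul (leqnn (K * n)%N) (ltnW hq).
  by rewrite -!mulnn in h1 *; lia.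
exact: arith blocks leL nL leM.
Qed.

Lemma max_nu_ub (k n : nat) :
  (k.+1 * (2 * \max_(s : n.-tuple 'I_k.+1) nu pattern_11_2 s) + n ^ 2
    <= k.+1 * n ^ 2)%N.
Proof.
have word : (0 < #|{: n.-tuple 'I_k.+1}|)%N.
  by apply/card_gt0P; exists [tuple ord0 | _ < n].
have [s ->] := bigop.eq_bigmax (nu pattern_11_2 (n:=n)) word.
exact: nu_11_2_ub.
Qed.

Lemma max_nu_mono (k n : nat) :
  (\max_(s : n.-tuple 'I_k) nu pattern_11_2 s <=
   \max_(s : n.-tuple 'I_k.+1) nu pattern_11_2 s)%N.
Proof.
apply/bigmax_leqP => s _.
pose s' : n.-tuple 'I_k.+1 := [tuple of map (widen_ord (leqnSn k)) s].
apply: (leq_trans _ (leq_bigmax s')).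
rewrite !nu_11_2E /letter -map_comp.
by rewrite (@eq_map _ _ (_ \o _) val).
Qed.

(** * Densities and their limits *)

Local Open Scope classical_set_scope.

Lemma density_11_2E (R : realType) (k m : nat) :
  density R pattern_11_2 k (m + 3) =
  (2 * (\max_(s : (m + 3).-tuple 'I_k) nu pattern_11_2 s)%:R)
    / ((m%:R + 2) * (m%:R + 1)).
Proof.
rewrite /density; set M := (\max_ _ _)%N.
have -> : (m + 3 - plength pattern_11_2 + nblocks pattern_11_2 = m.+2)%N.
  by rewrite /plength /nblocks /=; lia.
have e : 2 * 'C(m.+2, 2)%:R = (m%:R + 2) * (m%:R + 1) :> R.
  have : (2 * 'C(m.+2, 2) = (m + 2) * (m + 1))%N.
    by rewrite -mul_bin_diag bin1; lia.
  by move=> /(congr1 (fun x => x%:R : R)); rewrite !natrM !natrD.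
by rewrite -e -mulf_div divff ?mul1r // pnatr_eq0.
Qed.

(** The error is of order [1 / m] for fixed [k]; the constant 4 comes from
    [(m + 3) ^ 2 / ((m + 2) * (m + 1)) <= 1 + 4 / (m + 1)]. *)
Lemma density_ub (R : realType) (k m : nat) :
  density R pattern_11_2 k.+1 (m + 3) <= 1 - k.+1%:R^-1 + 4 * harmonic m.
Proof.
rewrite density_11_2E ler_pdivrMr; last first.
  by rewrite mulr_gt0 // -natrD ltr0n addnS.
have := max_nu_ub k (m + 3); set M := (\max_ _ _)%N => ub.
have {}ub : k.+1%:R * (2 * M%:R) + (m%:R + 3) ^+ 2
    <= k.+1%:R * (m%:R + 3) ^+ 2 :> R.
  by move: ub; rewrite -(ler_nat R) !(natrD, natrM, natrX).
have K0 : 0 < k.+1%:R :> R by rewrite ltr0n.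
have m0 : 0 <= m%:R :> R by rewrite ler0n.
rewrite /harmonic /= -(@natr1 _ m).
set x := m%:R in ub m0 *; set K := k.+1%:R in ub K0 *.
have K1 : 1 <= K by rewrite /K ler1n.
have iK : K^-1 <= 1 by rewrite invf_le1.
have {}ub : 2 * M%:R <= (1 - K^-1) * (x + 3) ^+ 2.
  rewrite -(ler_pM2l K0); have -> : K * ((1 - K^-1) * (x + 3) ^+ 2) =
    K * (x + 3) ^+ 2 - (x + 3) ^+ 2 by field; rewrite gt_eqF.
  lra.
apply: (le_trans ub).
have -> : (1 - K^-1 + 4 * (x + 1)^-1) * ((x + 2) * (x + 1)) =
  (1 - K^-1) * ((x + 2) * (x + 1)) + 4 * (x + 2).
  by field; rewrite !gt_eqF //; lra.
have : 0 <= K^-1 * (3 * x + 7).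
  by rewrite mulr_ge0 ?invr_ge0 ?(ltW K0) //; lra.
move: (K^-1) => i; lra.
Qed.

Lemma density_lb (R : realType) (k m : nat) :
  1 - k.+1%:R^-1 - (2 + 4 * k.+1%:R) * harmonic m
    <= density R pattern_11_2 k.+1 (m + 3).
Proof.
rewrite density_11_2E ler_pdivlMr; last first.
  by rewrite mulr_gt0 // -natrD ltr0n addnS.
have := max_nu_lb k (m + 3); set M := (\max_ _ _)%N => lb.
have {}lb : k.+1%:R * (m%:R + 3) ^+ 2 <= k.+1%:R * (2 * M%:R) + (m%:R + 3) ^+ 2
     + (k.+1%:R + 2 * k.+1%:R ^+ 2) * (m%:R + 3) :> R.
  by move: lb; rewrite -(ler_nat R) !(natrD, natrM, natrX).
have K0 : 0 < k.+1%:R :> R by rewrite ltr0n.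
have m0 : 0 <= m%:R :> R by rewrite ler0n.
rewrite /harmonic /= -(@natr1 _ m).
set x := m%:R in lb m0 *; set K := k.+1%:R in lb K0 *.
have K1 : 1 <= K by rewrite /K ler1n.
have iK : K^-1 <= 1 by rewrite invf_le1.
have {}lb : (1 - K^-1) * (x + 3) ^+ 2 - (1 + 2 * K) * (x + 3) <= 2 * M%:R.
  rewrite -(ler_pM2l K0) mulrBr; have -> : K * ((1 - K^-1) * (x + 3) ^+ 2) =
    K * (x + 3) ^+ 2 - (x + 3) ^+ 2 by field; rewrite gt_eqF.
  lra.
apply: (le_trans _ lb).
have -> : (1 - K^-1 - (2 + 4 * K) * (x + 1)^-1) * ((x + 2) * (x + 1)) =
  (1 - K^-1) * ((x + 2) * (x + 1)) - (2 + 4 * K) * (x + 2).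
  by field; rewrite !gt_eqF //; lra.
have : 0 <= (1 - K^-1) * (3 * x + 7).
  by rewrite mulr_ge0 ?subr_ge0 //; lra.
have : 0 <= (1 + 2 * K) * (x + 1) by rewrite mulr_ge0 //; lra.
move: (K^-1) => i; lra.
Qed.

Lemma cvg_density_n (R : realType) (k : nat) :
  density R pattern_11_2 k.+1 n @[n --> \oo] --> (1 - k.+1%:R^-1 : R).
Proof.
rewrite -(cvg_shiftn 3).
have harm (c a : R) : c + a * harmonic m @[m --> \oo] --> c.
  rewrite -[X in _ --> X]addr0 -[X in _ + X](mulr0 a).
  apply: cvgD; first exact: cvg_cst.
  by apply: cvgMr; exact: cvg_harmonic.
apply: (@squeeze_cvgr _ _ _ _
  (fun m => 1 - k.+1%:R^-1 + - (2 + 4 * k.+1%:R) * harmonic m)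
  (fun m => 1 - k.+1%:R^-1 + 4 * harmonic m)).
- by apply: nearW => m; rewrite mulNr density_lb density_ub.
- exact: harm.
- exact: harm.
Qed.

Lemma density_mono (R : realType) (n : nat) :
  nondecreasing_seq (fun k => density R pattern_11_2 k n).
Proof.
apply/nondecreasing_seqP => k.
by rewrite /density ler_wpM2r ?invr_ge0 ?ler0n // ler_nat max_nu_mono.
Qed.

(** A bound uniform in [k], so that it passes to the limit in [k]. *)
Lemma density_le (R : realType) (k m : nat) :
  density R pattern_11_2 k (m + 3) <= 1 + 4 * harmonic m.
Proof.
apply: (le_trans (density_mono R _ _ _ (leqnSn k))).
apply: (le_trans (density_ub R k m)).
by rewrite lerD2r gerBl invr_ge0.
Qed.

Lemma is_cvg_density_k (R : realType) (m : nat) :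
  cvgn (fun k => density R pattern_11_2 k (m + 3)).
Proof.
apply: nondecreasing_is_cvgn; first exact: density_mono.
by exists (1 + 4 * harmonic m) => _ [k _ <-]; exact: density_le.
Qed.

(** The limit in [k] at length [n] is at least the density at any fixed [K],
    which tends to [1 - 1 / K] with [n], and [K] is arbitrary. *)
Lemma cvg_lim_density_k (R : realType) :
  limn (fun k => density R pattern_11_2 k n) @[n --> \oo] --> (1 : R).
Proof.
rewrite -(cvg_shiftn 3); apply/cvgrPdist_le => e e0.
have ub0 : 4 * @harmonic R m @[m --> \oo] --> 0.
  by rewrite -[X in _ --> X](mulr0 4); apply: cvgMr; exact: cvg_harmonic.
have [K _ /(_ K (leqnn K)) hK] : \forall k \near \oo, @harmonic R k < e.
  exact: (cvgr_lt _ (@cvg_harmonic R)).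
have lt1 : 1 - e < 1 - K.+1%:R^-1 by rewrite ltrD2l ltrN2.
have cK := cvg_density_n R K; rewrite -(cvg_shiftn 3) in cK.
near=> m; rewrite ler_distlC; apply/andP; split.
  apply: (@le_trans _ _ (density R pattern_11_2 K.+1 (m + 3))).
    by apply: ltW; near: m; exact: (cvgr_gt _ cK).
  pose u k := density R pattern_11_2 k (m + 3).
  apply: (@nondecreasing_cvgn_le _ u); first exact: density_mono.
  exact: is_cvg_density_k.
apply: (@le_trans _ _ (1 + 4 * harmonic m)).
  apply: limr_le; first exact: is_cvg_density_k.
  by apply: nearW => k; exact: density_le.
by rewrite lerD2l; apply: ltW; near: m; exact: (cvgr_lt _ ub0).
Unshelve. all: by end_near. Qed.

Lemma cvg_lim_density_n (R : realType) :
  limn (fun n => density R pattern_11_2 k n) @[k --> \oo] --> (1 : R).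
Proof.
rewrite -(cvg_shiftn 1).
have -> : (fun k => limn (fun n => density R pattern_11_2 (k + 1) n)) =
    (fun k => 1 - harmonic k).
  by apply/funext => k; rewrite addn1; exact: (cvg_lim _ (cvg_density_n R k)).
have : 1 - harmonic k @[k --> \oo] --> (1 - 0 : R).
  by apply: cvgB; [exact: cvg_cst|exact: cvg_harmonic].
by rewrite subr0.
Qed.

Theorem proposition3p6 (R : realType) :
  (delta_exists R pattern_11_2 /\ delta R pattern_11_2 = 1) /\
  (delta'_exists R pattern_11_2 /\ delta' R pattern_11_2 = 1).
Proof.
split; split.
- split; last by apply/cvg_ex; exists 1; exact: cvg_lim_density_k.
  by move=> n n3; rewrite -(@subnK 3 n) //; exact: is_cvg_density_k.
- exact: (cvg_lim _ (cvg_lim_density_k R)).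
- split; last by apply/cvg_ex; exists 1; exact: cvg_lim_density_n.
  by case=> // k _; apply/cvg_ex; exists (1 - k.+1%:R^-1); exact: cvg_density_n.
- exact: (cvg_lim _ (cvg_lim_density_n R)).
Qed.
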